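(* For any real speedup $s$ with $1\le s\le 2$, algorithm SPEEDUP (run with speed $s$) returns a service run traveling at speed $s$ whose total profit is at least $\frac{s+1}{6\gamma}\,\mathrm{profit}(R^* )$, where $R^*$ is a maximum-profit unit-speed service run for the original untrimmed windows; i.e. SPEEDUP is a $6\gamma/(s+1)$-approximation to the traveling repairman problem with unit-time windows. Its running time is $O(\min\{r,m\}\,\Gamma(n))$, where $s=q/r$ in lowest terms if $s$ is rational and $r=\infty$ if $s$ is irrational.
   Context: Problem: an undirected graph with metric edge lengths (either a tree or a general metric graph) on $n$ nodes, and $m$ service requests; request $i$ is located at a node $v_i$, has a nonnegative profit, and has a time window $[w_i,w_i+1)$ of unit length. A service run at speed $\sigma$ is a route that may start at any node at any time (unrooted) and covers distance at most $\sigma t$ in any time interval of length $t$; it earns the profit of request $i$ (at most once) if it is at $v_i$ at some time in the window of request $i$. $R^*$ is a speed-$1$ service run of maximum total profit for the untrimmed windows. Trimming with offset $h$: periods $[h+j/2,h+(j+1)/2)$, $j\in\mathbb{Z}$; assuming (after a slight perturbation if necessary) that no window starts on a period boundary, each window contains exactly one period entirely and is replaced by it. REPAIR: an algorithm that, given a trimmed instance and speed $\sigma$, returns in time $\Gamma(n)$ a speed-$\sigma$ run whose profit on the trimmed windows is at least $1/\gamma$ times the maximum such profit of any speed-$\sigma$ run; $\gamma=1$, $\Gamma(n)=O(n^4)$ for trees, and $\gamma=2+\epsilon$, $\Gamma(n)=O(n^{O(1/\epsilon^2)})$ for metric graphs. CANONICAL offsets: for each window start $t_i$ let $a_i$ be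 the largest integer with $a_i/2<t_i$, $h_i=t_i-a_i/2$; sort $h_1\le\dots\le h_m$; the offsets are $0$ and $(h_{i-1}+h_i)/2$ for $i=2,\dots,m$. SPEEDUP with speed $s$: if $s=q/r$ is rational in lowest terms with $r<m$, use the $r$ offsets spread uniformly in $[0,1/2)$, namely $(i-1)/(2r)$ for $i=1,\dots,r$; otherwise use the CANONICAL offsets. For each offset, trim the windows, run REPAIR at speed $s$ on the trimmed instance, and return the best run found. A $\rho$-approximation returns a run of profit at least $\mathrm{profit}(R^* )/\rho$.
   Formalization: The running-time bound is stated for 1 ≤ m ≤ Γ(n), and REPAIR's time bound is assumed only for instances with at most Γ(n) requests, since otherwise reading or trimming the m requests already exceeds the claimed time; REPAIR also reports the profit of its run. *)

(* Defs.v *)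
From mathcomp Require Import all_boot all_order all_algebra.
From mathcomp Require Import all_classical all_reals.
From mathcomp Require Import lra.

Set Implicit Arguments.
Unset Strict Implicit.
Unset Printing Implicit Defensive.
Import Order.TTheory GRing.Theory Num.Theory.
Local Open Scope ring_scope.

Fixpoint walk_length (R : realType) (V : Type) (len : V -> V -> R)
    (u : V) (p : seq V) : R :=
  if p is v :: p' then len u v + walk_length len v p' else 0.

(* [len] is meaningful on adjacent pairs only.  [len_metric]: no walk is a
   shortcut for an edge. *)
Record metric_graph (R : realType) := MetricGraph {
  vertex : finType;
  adj : rel vertex;
  len : vertex -> vertex -> R;
  vertex_gt0 : (0 < #|vertex|)%N;
  adj_sym : symmetric adj;
  adj_irr : irreflexive adj;
  adj_connected : forall u v, connect adj u v;
  len_sym : forall u v, adj u v -> len u v = len v u;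
  len_gt0 : forall u v, adj u v -> 0 < len u v;
  len_metric : forall u p, path adj u p -> adj u (last u p) ->
    len u (last u p) <= walk_length len u p
}.

(* Connectedness is part of [metric_graph]; [ucycle adj [:: u; v]] holds for
   every edge, hence the bound 2. *)
Definition is_tree (R : realType) (G : metric_graph R) : Prop :=
  forall c : seq (vertex G), ucycle (@adj R G) c -> (size c <= 2)%N.

Variant network_kind := TreeNetwork | MetricNetwork.

Definition of_kind (R : realType) (k : network_kind) (G : metric_graph R) :
    Prop :=
  if k is TreeNetwork then is_tree G else True.

(* A run stays at [place a] during [arrive a, depart a] and, between consecutive
   stops, moves along an edge at constant speed. *)
Record stop (R : realType) (G : metric_graph R) := Stop {
  place : vertex G;
  arrive : R;
  depart : R
}.

Record service_run (R : realType) (G : metric_graph R) := ServiceRun {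
  first_stop : stop G;
  next_stops : seq (stop G)
}.

Definition stops (R : realType) (G : metric_graph R) (rho : service_run G) :
    seq (stop G) :=
  first_stop rho :: next_stops rho.

Definition leg (R : realType) (G : metric_graph R) (sigma : R)
    (a b : stop G) : bool :=
  adj (place a) (place b) &&
  (len (place a) (place b) <= sigma * (arrive b - depart a)).

Definition runs_at_speed (R : realType) (G : metric_graph R) (sigma : R)
    (rho : service_run G) : bool :=
  all (fun a => arrive a <= depart a) (stops rho) &&
  path (leg sigma) (first_stop rho) (next_stops rho).

Definition at_node (R : realType) (G : metric_graph R) (rho : service_run G)
    (v : vertex G) (t : R) : bool :=
  has (fun a => (place a == v) && (arrive a <= t <= depart a)) (stops rho).

Definition serves (R : realType) (G : metric_graph R) (rho : service_run G)
    (v : vertex G) (lo hi : R) : Prop :=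
  exists t, (lo <= t < hi) && at_node rho v t.

(* The window of [q] is [wstart q, wstart q + 1). *)
Record request (R : realType) (G : metric_graph R) := Request {
  site : vertex G;
  profit : R;
  profit_ge0 : 0 <= profit;
  wstart : R
}.

Definition total_profit (R : realType) (G : metric_graph R)
    (reqs : seq (request G)) (rho : service_run G) : R :=
  \sum_(q <- reqs | `[< serves rho (site q) (wstart q) (wstart q + 1) >])
    profit q.

Definition is_optimal (R : realType) (G : metric_graph R)
    (reqs : seq (request G)) (sigma : R) (rho : service_run G) : Prop :=
  runs_at_speed sigma rho /\
  forall rho', runs_at_speed sigma rho' ->
    total_profit reqs rho' <= total_profit reqs rho.

Definition period_start (R : realType) (h : R) (j : int) : R :=
  h + j%:~R / 2.

(* Relative to an offset [h], the window of a trimmed request is the period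
   [period_start h (period q), period_start h (period q + 1)). *)
Record trimmed_request (R : realType) (G : metric_graph R) := TrimmedRequest {
  tsite : vertex G;
  tprofit : R;
  tprofit_ge0 : 0 <= tprofit;
  period : int
}.

Record trimmed_instance (R : realType) (G : metric_graph R) :=
  TrimmedInstance {
  offset : R;
  trimmed_requests : seq (trimmed_request G)
}.

Definition trimmed_profit (R : realType) (G : metric_graph R)
    (I : trimmed_instance G) (rho : service_run G) : R :=
  \sum_(q <- trimmed_requests I |
        `[< serves rho (tsite q) (period_start (offset I) (period q))
                                 (period_start (offset I) (period q + 1)) >])
    tprofit q.

(* Cost model: a real RAM.  A [timed] value carries the number of unit steps
   spent; [op] marks one arithmetic operation, rounding or comparison, and list
   traversals are charged one step per cell. *)
Definition timed (A : Type) : Type := (A * nat)%type.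

Definition ret (A : Type) (x : A) : timed A := (x, 0%N).

Definition op (A : Type) (x : A) : timed A := (x, 1%N).

Definition bind (A B : Type) (e : timed A) (f : A -> timed B) : timed B :=
  let: (x, c) := e in let: (y, d) := f x in (y, (c + d)%N).

Notation "'let*' x := e 'in' f" := (bind e (fun x => f))
  (at level 200, x name, e at level 200, f at level 200).

Fixpoint map_timed (A B : Type) (f : A -> timed B) (s : seq A) :
    timed (seq B) :=
  if s is x :: s' then
    let* y := f x in
    let* ys := map_timed f s' in
    op (y :: ys)
  else ret [::].

Fixpoint insert_timed (R : realType) (x : R) (s : seq R) : timed (seq R) :=
  if s is y :: s' then
    let* b := op (x <= y) in
    if b then op [:: x, y & s']
    else let* t := insert_timed x s' in op (y :: t)
  else op [:: x].

Fixpoint sort_timed (R : realType) (s : seq R) : timed (seq R) :=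
  if s is x :: s' then
    let* t := sort_timed s' in insert_timed x t
  else ret [::].

Fixpoint midpoints_timed (R : realType) (s : seq R) : timed (seq R) :=
  if s is x :: s' then
    if s' is y :: _ then
      let* z := op (x + y) in
      let* m := op (z / 2) in
      let* ms := midpoints_timed s' in
      op (m :: ms)
    else ret [::]
  else ret [::].

(* The period kept for a window starting at [w] is the first one that begins at
   or after [w].  It is the only period inside the window when [w] is not a
   period boundary ([trim_period_unique]); when [w] is one, this is the outcome
   of perturbing [w] slightly downwards. *)
Definition trim_timed (R : realType) (G : metric_graph R) (h : R)
    (q : request G) : timed (trimmed_request G) :=
  let* d := op (wstart q - h) in
  let* x := op (2 * d) in
  let* j := op (Num.ceil x) in
  op (TrimmedRequest (site q) (profit_ge0 q) j).

Definition trim_all_timed (R : realType) (G : metric_graph R) (h : R)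
    (reqs : seq (request G)) : timed (trimmed_instance G) :=
  let* ts := map_timed (trim_timed h) reqs in
  op (TrimmedInstance h ts).

Lemma trim_period_inside (R : realType) (h w : R) :
  let j := Num.ceil (2 * (w - h)) in
  w <= period_start h j /\ period_start h (j + 1) <= w + 1.
Proof.
move=> j; have /andP[] := ceil_itv (2 * (w - h)); rewrite -/j /period_start.
rewrite intrB intrD; lra.
Qed.

Lemma trim_period_unique (R : realType) (h w : R) (i : int) :
  (forall j, w <> period_start h j) ->
  w <= period_start h i -> period_start h (i + 1) <= w + 1 ->
  i = Num.ceil (2 * (w - h)).
Proof.
move=> bdry le_wi le_iw; apply/esym/ceil_def.
have := bdry (i - 1); move: le_wi le_iw.
rewrite /period_start intrB intrD => le_wi le_iw /eqP.
rewrite neq_lt => /orP[] ?; apply/andP; split; lra.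
Qed.

(* [Num.ceil (2 * t) - 1] is the largest integer [a] with [a / 2 < t]
   ([half_integer_below]). *)
Definition phase_timed (R : realType) (G : metric_graph R) (q : request G) :
    timed R :=
  let* x := op (2 * wstart q) in
  let* c := op (Num.ceil x) in
  let* a := op (c - 1) in
  let* y := op (a%:~R / 2) in
  op (wstart q - y).

Lemma half_integer_below (R : realType) (t : R) :
  let a := Num.ceil (2 * t) - 1 in
  a%:~R / 2 < t /\ forall b : int, b%:~R / 2 < t -> b <= a.
Proof.
move=> a; split; first by have := ceilB1_lt (2 * t); rewrite -/a; lra.
move=> b lt_bt; rewrite /a lerBrDr lezD1 ceil_gt_int; lra.
Qed.

Definition canonical_offsets_timed (R : realType) (G : metric_graph R)
    (reqs : seq (request G)) : timed (seq R) :=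
  let* hs := map_timed (@phase_timed R G) reqs in
  let* sorted_hs := sort_timed hs in
  let* mids := midpoints_timed sorted_hs in
  op (0 :: mids).

Definition uniform_offsets_timed (R : realType) (r : nat) : timed (seq R) :=
  map_timed (fun i : nat =>
    let* a := op (i.-1%:R : R) in
    let* b := op (2 * r%:R : R) in
    op (a / b)) (iota 1 r).

Definition size_timed (A : Type) (s : seq A) : timed nat := (size s, size s).

(* The second component of the output is the trimmed profit of the returned run
   (see [repair_value]). *)
Definition repair_algorithm (R : realType) : Type :=
  forall G : metric_graph R, trimmed_instance G -> R ->
    timed (service_run G * R).

(* The time bound is required only of instances whose number of requests does
   not exceed [Gamma n], as the input has to be read within that time. *)
Record repair_spec (R : realType) (k : network_kind) (gamma : R)
    (Gamma : nat -> nat) (repair : repair_algorithm R) : Prop := RepairSpec {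
  repair_feasible : forall (G : metric_graph R) (I : trimmed_instance G) sigma,
    of_kind k G -> 0 < sigma ->
    runs_at_speed sigma (repair G I sigma).1.1;
  repair_value : forall (G : metric_graph R) (I : trimmed_instance G) sigma,
    of_kind k G -> 0 < sigma ->
    (repair G I sigma).1.2 = trimmed_profit I (repair G I sigma).1.1;
  repair_approx : forall (G : metric_graph R) (I : trimmed_instance G) sigma rho,
    of_kind k G -> 0 < sigma -> runs_at_speed sigma rho ->
    gamma^-1 * trimmed_profit I rho
      <= trimmed_profit I (repair G I sigma).1.1;
  repair_time : forall (G : metric_graph R) (I : trimmed_instance G) sigma,
    of_kind k G -> 0 < sigma ->
    (size (trimmed_requests I) <= Gamma #|vertex G|)%N ->
    ((repair G I sigma).2 <= Gamma #|vertex G|)%N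
}.

Fixpoint best_over_timed (R : realType) (G : metric_graph R)
    (repair : repair_algorithm R) (reqs : seq (request G)) (s : R)
    (offsets : seq R) (best : option (service_run G * R)) :
    timed (option (service_run G)) :=
  if offsets is h :: offsets' then
    let* I := trim_all_timed h reqs in
    let* out := repair G I s in
    let* better := op (if best is Some b then b.2 < out.2 else true) in
    best_over_timed repair reqs s offsets' (if better then Some out else best)
  else ret (omap fst best).

(* [r] is the denominator in lowest terms of the speed, [None] (infinity) if it
   is irrational; it is part of the representation of the speed [s] that the
   algorithm receives. *)
Variant speed_denominator (R : realType) (s : R) : option nat -> Prop :=
| RationalSpeed (q r : nat) of (0 < r)%N & coprime q r & s = q%:R / r%:R :
    speed_denominator s (Some r)
| IrrationalSpeed of (forall x : rat, s <> ratr x) :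
    speed_denominator s None.

Definition min_denominator (r : option nat) (m : nat) : nat :=
  if r is Some r' then minn r' m else m.

Definition speedup (R : realType) (G : metric_graph R)
    (repair : repair_algorithm R) (reqs : seq (request G)) (s : R)
    (r : option nat) : timed (option (service_run G)) :=
  let* m := size_timed reqs in
  let* uniform := op (if r is Some r' then (r' < m)%N else false) in
  let* offsets :=
    if uniform then uniform_offsets_timed R (odflt 0%N r)
    else canonical_offsets_timed reqs in
  best_over_timed repair reqs s offsets None.

Lemma optimal_run_exists (R : realType) (G : metric_graph R)
    (reqs : seq (request G)) (sigma : R) :
  exists rho, is_optimal reqs sigma rho.
Proof.
pose sv rho q := `[< @serves R G rho (site q) (wstart q) (wstart q + 1) >].
pose mk rho := [ffun i : 'I_(size reqs) => sv rho (tnth (in_tuple reqs) i)].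
pose val (f : {ffun 'I_(size reqs) -> bool}) :=
  \sum_(i | f i) profit (tnth (in_tuple reqs) i).
pose P f := `[< exists2 rho, runs_at_speed sigma rho & mk rho = f >].
have valE rho : total_profit reqs rho = val (mk rho).
  rewrite /total_profit big_tnth /val; apply: eq_bigl => i.
  by rewrite ffunE.
have [v _] : {v : vertex G | true}.
  have /card_gt0P/sigW[v _] := vertex_gt0 G; by exists v.
pose rho0 := ServiceRun (Stop v 0 0) [::].
have P0 : P (mk rho0).
  by apply/asboolP; exists rho0 => //; rewrite /runs_at_speed /= lexx.
case: (arg_maxP val P0) => f /asboolP[rho fr rf] fmax.
exists rho; split=> // rho' fr'; rewrite !valE rf.
by apply: fmax; apply/asboolP; exists rho'.
Qed.

(* Main.v *)
(* Let [tau] be the time at which the optimal unit-speed run serves a request and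
   [P] the start of the period kept by trimming.  A run of speed [s] can, in each
   period, sweep a stretch of length (s + 1)/4 of the optimal run forwards and
   spend the rest of the period going back, so that it advances by 1/2 per
   period.  Started [a] after the period boundaries, it serves every request with
   P + a <= tau < P + a + (s + 1)/4.
   Of the range -1/2 < tau - P < 1, six choices of [a] are used: stretches
   reaching down to about -(s + 1)/6 and their mirror images about 1/4, three
   of each so as to round (q + r)/3 both ways.  For s = q/r and the [r] uniform
   offsets every request is served in at least q + r of the 6r combinations, that
   is with frequency (s + 1)/6.
   Up to a translation in time, the canonical offsets realise every way of
   trimming; an irrational speed is approximated from below by rational ones. *)

Require Import Defs.
From mathcomp Require Import all_boot all_order all_algebra.
From mathcomp Require Import all_classical all_reals.
From mathcomp Require Import lra zify ring.
Import Order.TTheory GRing.Theory Num.Theory.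
Local Open Scope ring_scope.

Set Implicit Arguments.
Unset Strict Implicit.

Definition starts_at {R : realType} {G : metric_graph R} (rho : service_run G)
    (v : vertex G) (t : R) : Prop :=
  place (first_stop rho) = v /\ arrive (first_stop rho) = t.

(* Runs are prolonged backwards in time: [u] can be put in front of [v] when
   the clock allows a distance [d]. *)
Definition reaches {R : realType} {G : metric_graph R} (s d : R)
    (u v : vertex G) : Prop :=
  forall t t' rho, d <= s * (t' - t) -> runs_at_speed s rho ->
  starts_at rho v t' ->
  exists rho', [/\ runs_at_speed s rho', starts_at rho' u t &
    forall w x, at_node rho w x -> at_node rho' w x].

Section Routes.
Variables (R : realType) (G : metric_graph R) (s : R).
Hypothesis s_gt0 : 0 < s.
Implicit Types (u v w : vertex G) (rho : service_run G).

Lemma starts_at_node rho v t :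
  runs_at_speed s rho -> starts_at rho v t -> at_node rho v t.
Proof.
case: rho => a p /andP[/andP[/= ad _] _] [/= <- <-].
by rewrite /at_node /= eqxx lexx ad.
Qed.

Lemma reaches_refl d u : 0 <= d -> reaches s d u u.
Proof.
move=> d0 t t' [[v y z] p]; rewrite /runs_at_speed /starts_at /=.
move=> dt /andP[/andP[yz ap] pp] [vu yt']; rewrite {}vu {v} in pp *.
have tt' : t <= t' by rewrite -subr_ge0 -(pmulr_rge0 _ s_gt0); lra.
exists (ServiceRun (Stop u t z) p); split=> //=.
- have pp' : path (leg s) (Stop u t z) p by case: p {ap} pp.
  rewrite /runs_at_speed /= ap pp' !andbT.
  by rewrite (le_trans tt') // -yt'.
- move=> w x; rewrite /at_node /= => /orP[/andP[-> /andP[yx ->]]|->].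
    by rewrite andbT (le_trans tt') // -yt'.
  by rewrite orbT.
Qed.

Lemma reaches_edge d u v : adj u v -> len u v <= d -> reaches s d u v.
Proof.
move=> uv le_d t t' [b p] dt; rewrite /runs_at_speed /= => /andP[ap pp] [bv bt].
exists (ServiceRun (Stop u t t) (b :: p)); split=> //.
- rewrite /runs_at_speed /= lexx ap pp /leg /= bv bt uv /=.
  by rewrite (le_trans le_d).
- by move=> w x; rewrite /at_node /= => ->; rewrite orbT.
Qed.

Lemma reaches_le d d' u v : d <= d' -> reaches s d u v -> reaches s d' u v.
Proof. by move=> dd r t t' rho /(le_trans dd); exact: r. Qed.

Lemma reaches_trans d d' u v w :
  reaches s d u v -> reaches s d' v w -> reaches s (d + d') u w.
Proof.
move=> ruv rvw t t' rho dt ok st.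
pose x := t + d / s.
have xE : s * (x - t) = d by rewrite /x addrAC subrr add0r mulrC divfK ?gt_eqF.
have [|rho1 [ok1 st1 in1]] := rvw x t' rho _ ok st; first lra.
have [|rho2 [ok2 st2 in2]] := ruv t x rho1 _ ok1 st1; first lra.
by exists rho2; split=> // y z /in1/in2.
Qed.

Let visit v x (a : stop G) := (place a == v) && (arrive a <= x <= depart a).

Lemma reaches_from_first (a : stop G) (p : seq (stop G)) v x y :
  all (fun b => arrive b <= depart b) (a :: p) -> path (leg 1) a p ->
  arrive a <= x <= depart a -> has (visit v y) (a :: p) ->
  [/\ arrive a <= y, reaches s `|x - y| (place a) v
    & reaches s `|x - y| v (place a)].
Proof.
elim: p a x => [|b p IH] a x /= /andP[ad ap].
  move=> _ /andP[ax xd]; rewrite orbF => /andP[/eqP<- /andP[-> _]].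
  by split=> //; apply: reaches_refl.
move=> /andP[/andP[ab lab] pp] /andP[ax xd].
case/orP=> [/andP[/eqP<- /andP[-> _]]|hv].
  by split=> //; apply: reaches_refl.
have bd : arrive b <= arrive b <= depart b by rewrite lexx; case/andP: ap.
have [by_ r1 r2] := IH b (arrive b) ap pp bd hv.
have l0 := len_gt0 ab.
rewrite distrC ger0_norm in r1 r2; last lra.
rewrite distrC ger0_norm; last lra.
have -> : y - x = (arrive b - x) + (y - arrive b) by lra.
split; first lra.
- by apply: reaches_trans r1; apply: reaches_edge => //; lra.
- rewrite addrC; apply: (reaches_trans r2); apply: reaches_edge.
    by rewrite adj_sym.
  by rewrite -(len_sym ab); lra.
Qed.

Lemma reaches_along rho u v x y :
  runs_at_speed 1 rho -> at_node rho u x -> at_node rho v y ->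
  reaches s `|x - y| u v.
Proof.
case: rho => a p /andP[]; rewrite /at_node /stops /=.
elim: p a => [|b p IH] a ap pp hu hv.
  move: (hu); rewrite /= orbF => /andP[/eqP<- ux].
  by have [] := @reaches_from_first a [::] _ _ _ ap pp ux hv.
move: (hu) (hv) => /= /orP[|hu'].
  move=> /andP[/eqP<- ux] _.
  by have [] := @reaches_from_first a (b :: p) _ _ _ ap pp ux hv.
case/orP=> [|hv'].
  move=> /andP[/eqP<- ux]; rewrite distrC.
  by have [] := @reaches_from_first a (b :: p) _ _ _ ap pp ux hu.
by case/andP: ap pp => _ ap /andP[_ pp]; exact: (IH b ap pp hu' hv').
Qed.

Lemma run_through_sorted (e : R * vertex G) (l : seq (R * vertex G)) :
  {in e :: l &, forall p q, p.1 <= q.1 ->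
    reaches s (s * (q.1 - p.1)) p.2 q.2} ->
  path (fun p q => p.1 <= q.1) e l ->
  exists rho, [/\ runs_at_speed s rho, starts_at rho e.2 e.1 &
    {in e :: l, forall p, at_node rho p.2 p.1}].
Proof.
elim: l e => [|f l IH] e compat /=.
  move=> _; exists (ServiceRun (Stop e.2 e.1 e.1) [::]); split=> //.
    by rewrite /runs_at_speed /= lexx.
  by move=> p; rewrite inE => /eqP->; rewrite /at_node /= eqxx lexx.
case/andP=> ef pl.
have [p q pin qin|rho [ok st vis]] := IH f _ pl.
  by apply: compat; rewrite inE (pin, qin) orbT.
have re : reaches s (s * (f.1 - e.1)) e.2 f.2.
  by apply: compat; rewrite // !inE eqxx ?orbT.
have [rho' [ok' st' vis']] := re _ _ _ (lexx _) ok st.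
exists rho'; split=> // p; rewrite inE => /orP[/eqP->|/vis/vis'//].
exact: starts_at_node.
Qed.

Lemma run_through (l : seq (R * vertex G)) :
  {in l &, forall p q, p.1 <= q.1 -> reaches s (s * (q.1 - p.1)) p.2 q.2} ->
  exists2 rho, runs_at_speed s rho & {in l, forall p, at_node rho p.2 p.1}.
Proof.
move=> compat; pose le1 (p q : R * vertex G) := p.1 <= q.1.
have le1_total : total le1 by move=> p q; apply: le_total.
have := sort_sorted le1_total l; have := mem_sort le1 l.
case: (sort le1 l) => [|e l'] mem_l.
  move=> _; have /card_gt0P[v _] := vertex_gt0 G.
  exists (ServiceRun (Stop v 0 0) [::]); first by rewrite /runs_at_speed /= lexx.
  by move=> p; rewrite -mem_l.
move=> srt; have [p q|rho [ok _ vis]] := @run_through_sorted e l' _ srt.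
  by rewrite !mem_l; apply: compat.
by exists rho => // p; rewrite -mem_l; apply: vis.
Qed.

(* In every period [P, P + 1/2) the run sweeps, at speed [s], the stretch
   [P + a, P + a + (s + 1)/4) of the unit-speed run, and what is left of the
   period is just enough to come back to [P + a + 1/2]. *)
Lemma sweeping_run rho (I : finType) (A : pred I) (site : I -> vertex G)
    (time : I -> R) (per : I -> int) (h a : R) :
  1 <= s -> runs_at_speed 1 rho ->
  (forall i, A i -> at_node rho (site i) (time i)) ->
  (forall i, A i -> 0 <= time i - period_start h (per i) - a < (s + 1) / 4) ->
  exists2 rho', runs_at_speed s rho' &
    forall i, A i -> serves rho' (site i) (period_start h (per i))
                                          (period_start h (per i + 1)).
Proof.
move=> s1 ok vis swept; pose P i := period_start h (per i).
pose t i := P i + (time i - P i - a) / s.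
have tE i : s * t i = s * P i + (time i - P i - a).
  by rewrite /t mulrDr [X in _ + X]mulrC divfK ?gt_eqF.
have [|rho' ok' vis'] := @run_through [seq (t i, site i) | i <- enum A].
  move=> _ _ /mapP[i iA ->] /mapP[k kA ->] /=.
  rewrite !mem_enum in iA kA => tik.
  apply: (@reaches_le `|time i - time k|); last first.
    exact: reaches_along (vis _ _) (vis _ _).
  have := swept i iA; have := swept k kA; rewrite -/(P i) -/(P k).
  move=> /andP[k1 k2] /andP[i1 i2].
  have s_tik : s * t i <= s * t k by rewrite ler_pM2l.
  rewrite mulrBr; move: s_tik; rewrite !tE => s_tik.
  have [lt_ik|lt_ki|eq_ik] := ltgtP (per i) (per k).
  - have D : P k - P i >= 1 / 2.
      have : ((per i + 1)%:~R : R) <= (per k)%:~R by rewrite ler_int lezD1.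
      by rewrite /P /period_start intrD; lra.
    have : 0 <= (s - 1) * (P k - P i - 1 / 2) by apply: mulr_ge0; lra.
    by rewrite ler_norml => ?; apply/andP; split; lra.
  - have D : P i - P k >= 1 / 2.
      have : ((per k + 1)%:~R : R) <= (per i)%:~R by rewrite ler_int lezD1.
      by rewrite /P /period_start intrD; lra.
    have : 0 <= (s - 1) * (P i - P k - 1 / 2) by apply: mulr_ge0; lra.
    by lra.
  - have D : P i = P k by rewrite /P eq_ik.
    by rewrite ler_norml; rewrite D in s_tik i1 i2 *; apply/andP; split; lra.
exists rho' => // i iA; exists (t i).
have := vis' (t i, site i); rewrite /= => -> //; last first.
  by apply: map_f; rewrite mem_enum.
have /andP[i1 i2] := swept i iA; rewrite -/(P i) in i1 i2.
rewrite andbT /t; have -> : period_start h (per i + 1) = P i + 1 / 2.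
  by rewrite /P /period_start intrD; lra.
rewrite lerDl ltrD2l divr_ge0 ?(ltW s_gt0) //=.
by rewrite ltr_pdivrMr //; lra.
Qed.
End Routes.

Lemma count_interval (r : nat) (lo hi : int) :
  Num.max 0 (Num.min hi (r%:Z - 1) - Num.max lo (- 1)) <=
    (\sum_(k < r) ((lo < k%:Z) && (k%:Z <= hi))%R)%:Z.
Proof.
elim: r => [|r IH]; first by rewrite big_ord0; lia.
rewrite big_ord_recr /= PoszD.
move: IH; set S := (X in _ <= Posz X); rewrite -/S; clearbody S.
by case: (boolP ((lo < r%:Z) && (r%:Z <= hi))) => H; lia.
Qed.

(* For [0 <= b], the number of [k] in [0, r) with -b <= Z - 1 - k < l1 - b, plus
   the number of those with r + b - l2 <= Z - 1 - k < r + b. *)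
Definition overlap (Z r l1 l2 b : int) : int :=
  Num.max 0 (Num.min (Z + b) r - Num.max (Z + b - l1) 0)
  + Num.max 0 (Num.min (Z - r - b + l2) r - Num.max (Z - r - b) 0).

Lemma overlap_sym Z r l1 l2 b :
  overlap Z r l1 l2 b = overlap (2 * r - Z) r l2 l1 b.
Proof. by rewrite /overlap; lia. Qed.

Lemma overlap_cases Z r l1 l2 b :
  0 <= b <= l1 -> b <= r -> 0 <= Z <= r -> l2 <= r + b ->
  let t := overlap Z r l1 l2 b in
  let x := Z - r - b + l2 in
  [\/ [/\ Z + b <= r, Z + b <= l1, t >= Z + b & t >= Z + b + x],
      [/\ Z + b <= r, Z + b >= l1, t >= l1 & t >= l1 + x],
      [/\ Z + b >= r, Z + b <= l1, t >= r & t >= r + x] |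
      [/\ Z + b >= r, Z + b >= l1, t >= l1 - b - Z + r & t >= l1 - b - Z + r + x]].
Proof.
move=> h1 h2 h3 h4 t x; rewrite /t /x /overlap {t x}.
case: (leP (Z + b) r) => ?; case: (leP (Z + b) l1) => ?.
- by apply: Or41; split; lia.
- by apply: Or42; split; lia.
- by apply: Or43; split; lia.
- by apply: Or44; split; lia.
Qed.

Lemma overlap_sum Z r l1 l2 N b0 b1 b2 :
  b0 <= b1 <= b2 -> b2 <= b0 + 1 ->
  b0 + b1 + b2 = N -> l1 + l2 = N -> 0 <= b0 -> 0 < r -> 2 * r <= N <= 3 * r ->
  l1 <= l2 + 1 -> l2 <= l1 + 1 -> 0 <= Z <= r ->
  N <= overlap Z r l1 l2 b0 + overlap Z r l1 l2 b1 + overlap Z r l1 l2 b2.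
Proof.
move=> *.
have C b : b0 <= b <= b2 -> _ := fun hb =>
  @overlap_cases Z r l1 l2 b ltac:(lia) ltac:(lia) ltac:(lia) ltac:(lia).
have := C b0 ltac:(lia); have := C b1 ltac:(lia).
have := C b2 ltac:(lia); clear C.
do 3 (set t := overlap _ _ _ _ _; clearbody t; move: t => ?).
move=> /= C0 C1 C2.
by case: C0 => -[????]; case: C1 => -[????]; case: C2 => -[????]; lia.
Qed.

Lemma count_six_intervals (q r l1 l2 : nat) (Y : int) :
  (0 < r)%N -> (r <= q <= 2 * r)%N -> (l1 + l2 = q + r)%N ->
  (l1 <= l2.+1)%N -> (l2 <= l1.+1)%N -> -1 <= Y < (2 * r)%N%:Z ->
  (q + r <= \sum_(l < 3)
     (\sum_(k < r) ((Y + ((q + r + l) %/ 3)%N%:Z - l1%:Z < k%:Z)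
        && (k%:Z <= Y + ((q + r + l) %/ 3)%N%:Z))%R
      + \sum_(k < r) ((Y - r%:Z - ((q + r + l) %/ 3)%N%:Z < k%:Z)
        && (k%:Z <= Y - r%:Z - ((q + r + l) %/ 3)%N%:Z + l2%:Z))%R))%N.
Proof.
move=> r0 qr l12 l1l l2l Yr.
rewrite !big_ord_recl big_ord0 /= !addn0.
set b0 := ((q + r) %/ 3)%N; set b1 := ((q + r + bump 0 0) %/ 3)%N.
set b2 := ((q + r + bump 0 (bump 0 0)) %/ 3)%N.
have eb : (b0 + b1 + b2 = q + r)%N by rewrite /b0 /b1 /b2 /bump /=; lia.
have [b01 b12 b20] : [/\ b0 <= b1, b1 <= b2 & b2 <= b0.+1]%N.
  by rewrite /b0 /b1 /b2 /bump /=; split; lia.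
clearbody b0 b1 b2.
have H c : overlap (Y + 1) r l1 l2 c <=
    (\sum_(k < r) ((Y + c - l1%:Z < k%:Z) && (k%:Z <= Y + c))%R)%:Z
    + (\sum_(k < r) ((Y - r%:Z - c < k%:Z)
                       && (k%:Z <= Y - r%:Z - c + l2%:Z))%R)%:Z.
  have := count_interval r (Y + c - l1%:Z) (Y + c).
  have := count_interval r (Y - r%:Z - c) (Y - r%:Z - c + l2%:Z).
  rewrite /overlap.
  set S1 := (\sum_(_ < r) _)%N; set S2 := (\sum_(_ < r) _)%N.
  by clearbody S1 S2; lia.
have := H b0; have := H b1; have := H b2; clear H.
have : (q + r)%N%:Z <= overlap (Y + 1) r l1 l2 b0 + overlap (Y + 1) r l1 l2 b1
                       + overlap (Y + 1) r l1 l2 b2.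
  have [Zr|Zr] := leP (Y + 1) r%:Z; last rewrite !(overlap_sym (Y + 1)).
    by apply: overlap_sum; lia.
  by apply: overlap_sum; lia.
rewrite -lez_nat !PoszD.
move=> h h2 h1 h0; apply: (le_trans h); rewrite -addrA.
by apply: lerD; [exact: h0 | apply: lerD; [exact: h1 | exact: h2]].
Qed.

Definition kept_period {R : realType} (h w : R) : int := Num.ceil (2 * (w - h)).

Definition uniform_offset (R : realType) (r i : nat) : R := i%:R / (2 * r%:R).

Lemma kept_period_start (R : realType) (r i : nat) (w : R) (n : int) :
  (0 < r)%N -> (n = i%:Z %[mod r])%Z -> 2 * r%:R * w <= n%:~R ->
  n%:~R < 2 * r%:R * w + r%:R ->
  period_start (uniform_offset R r i) (kept_period (uniform_offset R r i) w)
  = n%:~R / (2 * r%:R).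
Proof.
move=> r0 /eqP; rewrite eqz_mod_dvd => /dvdzP[j nE] le_n lt_n.
have rR : 0 < r%:R :> R by rewrite ltr0n.
have {nE}nE : n%:~R = j%:~R * r%:R + i%:R :> R.
  have -> : n = j * r%:Z + i%:Z by rewrite -nE subrK.
  by rewrite intrD intrM.
have -> : kept_period (uniform_offset R r i) w = j.
  apply: ceil_def; rewrite /uniform_offset intrB.
  have -> : 2 * (w - i%:R / (2 * r%:R)) = (2 * r%:R * w - i%:R) / r%:R :> R.
    by field; rewrite gt_eqF.
  by rewrite ltr_pdivlMr // ler_pdivrMr //; apply/andP; split; lra.
rewrite /period_start /uniform_offset nE.
by field; rewrite gt_eqF.
Qed.

(* The trimmed windows of a request, over the [r] uniform offsets, start at [r]
   consecutive multiples of [1 / (2 * r)]. *)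
Lemma sum_uniform_offsets (R : realType) (r : nat) (w : R) (F : R -> nat) :
  (0 < r)%N ->
  (\sum_(i < r) F (period_start (uniform_offset R r i)
                    (kept_period (uniform_offset R r i) w))
   = \sum_(k < r) F ((Num.ceil (2 * r%:R * w) + k%:Z)%:~R / (2 * r%:R)))%N.
Proof.
move=> r0; set n0 := Num.ceil _.
have lt_mod (k : 'I_r) : (`|((n0 + k%:Z) %% r)%Z| < r)%N by lia.
pose f (k : 'I_r) := Ordinal (lt_mod k).
have f_inj : injective f.
  move=> [k kr] [l lr] /(congr1 val) /= kl; apply/val_inj => /=.
  have : ((n0 + k%:Z) = (n0 + l%:Z) %[mod r])%Z by lia.
  by move/eqP; rewrite eqz_modDl => /eqP; rewrite !modz_small; lia.
rewrite (reindex_inj f_inj); apply: eq_bigr => k _; congr F.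
have /andP[n1 n2] := ceil_itv (2 * r%:R * w); rewrite -/n0 in n1 n2.
have kr : (k%:R : R) <= r%:R - 1.
  by rewrite lerBrDr natr1 ler_nat.
have k0 : (0 : R) <= k%:R by rewrite ler0n.
apply: kept_period_start => //=.
- by rewrite gez0_abs ?modz_mod //; apply: modz_ge0; lia.
- by rewrite intrD; lra.
- by rewrite intrD; move: n1; rewrite intrB; lra.
Qed.

Definition sweep_start (R : realType) (q r : nat) (top : bool) (l : nat) : R :=
  let b := ((q + r + l) %/ 3)%:R in
  (if top then r%:R + b - (q + r)%:R / 2 else - b) / (2 * r%:R).

Definition swept {R : realType} (q r : nat) (x : R) : bool :=
  0 <= x < (q%:R / r%:R + 1) / 4.

Lemma split_half (R : realType) (N : nat) (phi : R) : 0 <= phi < 1 ->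
  exists l1 l2, [/\ (l1 + l2 = N)%N, (l1 <= l2.+1)%N, (l2 <= l1.+1)%N,
    phi + l1%:R - 1 < N%:R / 2 & l2%:R <= N%:R / 2 + phi].
Proof.
have := odd_double_half N; move: (odd N) N./2 => b M <-.
rewrite -addnn !natrD => /andP[p0 p1]; case: b => /=; last first.
  by exists M, M; split; [lia|lia|lia|lra|lra].
have [ph|ph] := ltP phi (1 / 2).
  by exists M.+1, M; rewrite -[M.+1%:R]natr1; split; [lia|lia|lia|lra|lra].
by exists M, M.+1; rewrite -[M.+1%:R]natr1; split; [lia|lia|lia|lra|lra].
Qed.

Lemma swept_count (R : realType) (q r : nat) (w tau : R) :
  (0 < r)%N -> (r <= q <= 2 * r)%N -> w <= tau < w + 1 ->
  (q + r <= \sum_(l < 3) \sum_(top : bool) \sum_(i < r)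
    swept q r (tau - period_start (uniform_offset R r i)
                    (kept_period (uniform_offset R r i) w)
               - sweep_start R q r top l))%N.
Proof.
move=> r0 qr /andP[w_tau tau_w].
have rR : 0 < r%:R :> R by rewrite ltr0n.
under eq_bigr => l _ do under eq_bigr => top _ do
  rewrite (@sum_uniform_offsets R r w
     (fun P => swept q r (tau - P - sweep_start R q r top l)) r0).
set n0 := Num.ceil _; pose x := 2 * r%:R * tau.
have /andP[n1 n2] := ceil_itv (2 * r%:R * w); rewrite -/n0 intrB in n1 n2.
have wx : 2 * r%:R * w <= x by rewrite ler_pM2l // mulr_gt0.
have xw : x < 2 * r%:R * w + 2 * r%:R.
  by rewrite -[X in _ + X]mulr1 -mulrDr ltr_pM2l // mulr_gt0.
pose Y := Num.floor x - n0; pose phi := x - (Num.floor x)%:~R.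
have /andP[f1 f2] := floor_itv x; rewrite intrD in f2.
have YE : (Num.floor x)%:~R = Y%:~R + n0%:~R :> R by rewrite -intrD subrK.
have Yr : -1 <= Y < (2 * r)%N%:Z.
  rewrite YE in f1 f2; apply/andP; split.
    have : (0 : R) < (Y + 2)%:~R by rewrite intrD; lra.
    by rewrite ltr0z; lia.
  by rewrite -(ltr_int R) /= -[(2 * r)%N%:~R]/((2 * r)%N%:R) natrM; lra.
have phi0 : 0 <= phi < 1 by rewrite /phi; apply/andP; split; lra.
have xE : x = n0%:~R + Y%:~R + phi by rewrite /phi YE; lra.
have sweptE (P a : R) : swept q r (tau - P / (2 * r%:R) - a / (2 * r%:R))
    = (0 <= x - P - a < (q + r)%:R / 2).
  have -> : tau - P / (2 * r%:R) - a / (2 * r%:R) = (x - P - a) / (2 * r%:R).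
    by rewrite /x; field; rewrite gt_eqF.
  have r2 : 0 < 2 * r%:R :> R by rewrite mulr_gt0.
  rewrite /swept ler_pdivlMr // mul0r ltr_pdivrMr //; congr (_ && (_ < _)).
  by rewrite natrD; field; rewrite gt_eqF.
have [l1 [l2 [l12 l1l l2l lb1 lb2]]] := split_half (q + r) phi0.
move: (congr1 (fun n => n%:R : R) l12); rewrite natrD => l12R.
apply: leq_trans (count_six_intervals r0 qr l12 l1l l2l Yr) _.
clear - phi0 sweptE xE lb1 lb2 l12R; clearbody x phi Y n0.
apply: leq_sum => l _; rewrite big_bool addnC /=.
apply: leq_add; apply: leq_sum => k _; rewrite /sweep_start sweptE;
  set b := ((q + r + l) %/ 3)%N; clearbody b;
  case: (boolP (_ && _)%R) => // /andP[k1 k2];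
  rewrite lt0b; move: k1 k2; rewrite -lezD1 -!(ler_int R);
  rewrite !(intrD, mulrNz) -!pmulrn => k1 k2; apply/andP; split; lra.
Qed.

Lemma map_timed_val (A B : Type) (f : A -> timed B) (l : seq A) :
  (map_timed f l).1 = [seq (f x).1 | x <- l].
Proof.
elim: l => //= x l <-; case: (f x) => y c.
by case: (map_timed f l).
Qed.

Lemma trim_all_offset (R : realType) (G : metric_graph R) (h : R)
    (reqs : seq (request G)) : offset (trim_all_timed h reqs).1 = h.
Proof. by rewrite /trim_all_timed /bind /=; case: map_timed. Qed.

Lemma trim_all_requests (R : realType) (G : metric_graph R) (h : R)
    (reqs : seq (request G)) :
  trimmed_requests (trim_all_timed h reqs).1 =
  [seq TrimmedRequest (site q) (profit_ge0 q) (kept_period h (wstart q))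
    | q <- reqs].
Proof.
rewrite /trim_all_timed /bind /=.
by have := map_timed_val (trim_timed h) reqs; case: map_timed => /= ? ? ->.
Qed.

Section Profits.
Variables (R : realType) (G : metric_graph R) (reqs : seq (request G)).
Implicit Types (rho : service_run G) (h : R).

Lemma trimmed_profit_trim h rho :
  trimmed_profit (trim_all_timed h reqs).1 rho =
  \sum_(q <- reqs | `[< serves rho (site q)
                          (period_start h (kept_period h (wstart q)))
                          (period_start h (kept_period h (wstart q) + 1)) >])
    profit q.
Proof. by rewrite /trimmed_profit trim_all_offset trim_all_requests big_map. Qed.

Lemma trimmed_profit_le h rho :
  trimmed_profit (trim_all_timed h reqs).1 rho <= total_profit reqs rho.
Proof.
rewrite trimmed_profit_trim /total_profit big_mkcond [leRHS]big_mkcond /=.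
apply: ler_sum => q _; case: asboolP => [[t /andP[/andP[t1 t2] at_t]]|_].
  case: asboolP => // -[]; exists t; rewrite at_t andbT.
  have [? ?] := trim_period_inside h (wstart q).
  by apply/andP; split; [apply: le_trans t1 | apply: lt_le_trans t2 _].
by case: ifP => // _; apply: profit_ge0.
Qed.

Lemma average_trimmed_profit (q r : nat) (Rstar : service_run G) (B : R) :
  (0 < r)%N -> (r <= q <= 2 * r)%N -> runs_at_speed 1 Rstar ->
  (forall i rho, (i < r)%N -> runs_at_speed (q%:R / r%:R) rho ->
    trimmed_profit (trim_all_timed (uniform_offset R r i) reqs).1 rho <= B) ->
  (q%:R / r%:R + 1) / 6 * total_profit reqs Rstar <= B.
Proof.
move=> r0 qr ok bound.
have rR : 0 < r%:R :> R by rewrite ltr0n.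
have s1 : 1 <= q%:R / r%:R :> R.
  by rewrite ler_pdivlMr // mul1r ler_nat; case/andP: qr.
pose req k := tnth (in_tuple reqs) k.
pose served k := `[< serves Rstar (site (req k)) (wstart (req k))
                            (wstart (req k) + 1) >].
have /choice[tau tauP] : forall k, exists t, served k ->
    (wstart (req k) <= t < wstart (req k) + 1) && at_node Rstar (site (req k)) t.
  move=> k; case: (boolP (served k)) => [/asboolP[t tP]|_]; last by exists 0.
  by exists t.
pose sw l top i k := swept q r (tau k
  - period_start (uniform_offset R r i)
      (kept_period (uniform_offset R r i) (wstart (req k)))
  - sweep_start R q r top l).
have one l top i : (i < r)%N ->
    \sum_(k | served k) (sw l top i k)%:R * profit (req k) <= B.
  move=> ir.
  have [||k /andP[kA kS]|rho okr vis] := @sweeping_run R G (q%:R / r%:R) _ Rstar _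
      (fun k => served k && sw l top i k) (fun k => site (req k)) tau
      (fun k => kept_period (uniform_offset R r i) (wstart (req k)))
      (uniform_offset R r i) (sweep_start R q r top l) s1 ok.
  - by apply: lt_le_trans s1.
  - by move=> k /andP[/tauP/andP[]].
  - exact: kS.
  apply: le_trans (bound i rho ir okr).
  rewrite trimmed_profit_trim (big_tnth _ _ reqs) big_mkcond [leRHS]big_mkcond /=.
  apply: ler_sum => k _; case: (boolP (served k)) => kA; last first.
    by case: ifP => // _; apply: profit_ge0.
  case: (boolP (sw l top i k)) => kS; last first.
    by rewrite mul0r; case: ifP => // _; apply: profit_ge0.
  by rewrite mul1r; case: asboolP => // -[]; apply: vis; rewrite kA.
have : \sum_(l < 3) \sum_(top : bool) \sum_(i < r)
    \sum_(k | served k) (sw l top i k)%:R * profit (req k) <= 6 * r%:R * B.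
  have -> : 6 * r%:R * B = \sum_(l < 3) \sum_(top : bool) \sum_(i < r) B.
    rewrite !sumr_const !card_ord card_bool -!mulrnA -[RHS]mulr_natl !natrM.
    by ring.
  apply: ler_sum => l _; apply: ler_sum => top _; apply: ler_sum => i _.
  exact: one.
have : (q + r)%:R * total_profit reqs Rstar <= \sum_(l < 3) \sum_(top : bool)
    \sum_(i < r) \sum_(k | served k) (sw l top i k)%:R * profit (req k).
  under eq_bigr => l _ do under eq_bigr => top _ do rewrite exchange_big /=.
  under eq_bigr => l _ do rewrite exchange_big /=.
  rewrite exchange_big /= /total_profit (big_tnth _ _ reqs) mulr_sumr.
  apply: ler_sum => k /tauP/andP[wk _].
  under eq_bigr => l _ do under eq_bigr => top _ do
    rewrite -mulr_suml -natr_sum.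
  under eq_bigr => l _ do rewrite -mulr_suml -natr_sum.
  rewrite -mulr_suml -natr_sum ler_wpM2r ?profit_ge0 // ler_nat.
  exact: swept_count.
move=> /le_trans H /H{H}; rewrite natrD.
have -> : (q%:R / r%:R + 1) / 6 * total_profit reqs Rstar
   = (q%:R + r%:R) * total_profit reqs Rstar / (6 * r%:R).
  by field; rewrite gt_eqF.
by move=> H; rewrite ler_pdivrMr ?mulr_gt0 // [leRHS]mulrC.
Qed.

Definition shift_stop (d : R) (a : stop G) : stop G :=
  Stop (place a) (arrive a + d) (depart a + d).

Definition shift_run (d : R) rho : service_run G :=
  ServiceRun (shift_stop d (first_stop rho)) (map (shift_stop d) (next_stops rho)).

Lemma shift_runs_at_speed s d rho :
  runs_at_speed s rho -> runs_at_speed s (shift_run d rho).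
Proof.
case: rho => a p; rewrite /runs_at_speed /= lerD2r => /andP[/andP[-> ap] pp] /=.
apply/andP; split.
  by move: ap; rewrite all_map; apply: sub_all => b /=; rewrite lerD2r.
rewrite path_map; apply: sub_path pp => b c.
by rewrite /leg /= opprD addrACA subrr addr0.
Qed.

Lemma shift_at_node d rho v t : at_node rho v t -> at_node (shift_run d rho) v (t + d).
Proof.
rewrite /at_node /stops /= has_map !lerD2r => /orP[->//|hp].
by apply/orP; right; apply: sub_has hp => b /=; rewrite !lerD2r.
Qed.

Lemma shift_serves d rho v lo hi :
  serves rho v lo hi -> serves (shift_run d rho) v (lo + d) (hi + d).
Proof.
case=> t /andP[tlh at_t]; exists (t + d).
by rewrite lerD2r ltrD2r tlh shift_at_node.
Qed.

Lemma shift_trimmed_profit h h' d rho :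
  (forall k, let w := wstart (tnth (in_tuple reqs) k) in
    period_start h' (kept_period h' w) = period_start h (kept_period h w) + d) ->
  trimmed_profit (trim_all_timed h reqs).1 rho
    <= trimmed_profit (trim_all_timed h' reqs).1 (shift_run d rho).
Proof.
move=> hh'; rewrite !trimmed_profit_trim !(big_tnth _ _ reqs).
rewrite big_mkcond [leRHS]big_mkcond /=; apply: ler_sum => k _.
case: asboolP => [/(shift_serves d)|_]; last first.
  by case: ifP => // _; apply: profit_ge0.
case: asboolP => // not_served; rewrite -hh' => served; case: not_served.
move: served; have := hh' k; rewrite /period_start /= !intrD => hk.
by congr serves; lra.
Qed.
End Profits.

Section CanonicalOffsets.
Variable R : realType.
Implicit Types (x y h : R) (l : seq R).

Lemma insert_timed_perm x l : perm_eq (insert_timed x l).1 (x :: l).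
Proof.
elim: l => //= y l IH; case: ifP => //= _.
case: (insert_timed x l) IH => t c /= IH.
apply: (@perm_trans _ (y :: x :: l)); first by rewrite perm_cons.
exact: (permEl (perm_catCA [:: y] [:: x] l)).
Qed.

Lemma insert_timed_sorted x l :
  sorted <=%R l -> sorted <=%R (insert_timed x l).1.
Proof.
elim: l => //= y l IH; have [xy|/ltW yx] := leP x y => /= srt.
  by rewrite xy.
have := IH (path_sorted srt); have := perm_mem (insert_timed_perm x l).
case: (insert_timed x l) => t c /= mem_t; rewrite (path_sortedE le_trans) => st.
rewrite st andbT; apply/allP => z; rewrite mem_t inE.
by case/orP=> [/eqP->//|]; apply/allP; apply: order_path_min srt; apply: le_trans.
Qed.

Lemma sort_timed_perm l : perm_eq (sort_timed l).1 l.
Proof.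
elim: l => //= x l; case: (sort_timed l) => t c /= IH.
have := insert_timed_perm x t; case: (insert_timed x t) => u d /= H.
by apply: (perm_trans H); rewrite perm_cons.
Qed.

Lemma sort_timed_sorted l : sorted <=%R (sort_timed l).1.
Proof.
elim: l => //= x l; case: (sort_timed l) => t c /= IH.
by have := insert_timed_sorted x IH; case: (insert_timed x t).
Qed.

Lemma midpoint_around l h : sorted <=%R l -> has (<= h) l -> has (> h) l ->
  exists x y, [/\ (x + y) / 2 \in (midpoints_timed l).1, x \in l, y \in l, x <= h < y &
    {in l, forall z, z <= x \/ y <= z}].
Proof.
elim: l => // x [|y l] IH.
  by rewrite /= !orbF => _ xh; rewrite ltNge xh.
move=> /= /andP[xy srt] has_le has_gt.
have midE : (midpoints_timed [:: x, y & l]).1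
    = (x + y) / 2 :: (midpoints_timed (y :: l)).1.
  by rewrite /=; case: (match l with nil => _ | cons _ _ => _ end).
have minl : {in l, forall z, y <= z}.
  by apply/allP; apply: order_path_min srt; apply: le_trans.
have [yh|hy] := leP y h.
  have [] := IH srt.
  - by rewrite /= yh.
  - by case/orP: has_gt => //; rewrite ltNge (le_trans xy yh).
  move=> a [b [ab_in al bl /andP[ah hb] abP]]; exists a, b; split=> //.
  - by rewrite midE inE ab_in orbT.
  - by rewrite inE al orbT.
  - by rewrite inE bl orbT.
  - by rewrite ah hb.
  move=> z; rewrite inE => /orP[/eqP->|]; last exact: abP.
  have [ya|by_] := abP y (mem_head _ _); first by left; apply: le_trans ya.
  by have := le_lt_trans yh hb; rewrite ltNge by_.
exists x, y; split.
- by rewrite midE inE eqxx.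
- by rewrite inE eqxx.
- by rewrite !inE eqxx orbT.
- rewrite hy andbT; case/orP: has_le => //.
  rewrite leNgt hy /= => /hasP[z zl]; rewrite /= => zh.
  by have := le_trans (minl z zl) zh; rewrite leNgt hy.
move=> z; rewrite !inE => /orP[/eqP->|/orP[/eqP->|/minl]]; by [left|right].
Qed.

Variable G : metric_graph R.

Definition phase (w : R) : R := w - (Num.ceil (2 * w) - 1)%:~R / 2.

Lemma phase_gt0_le (w : R) : 0 < phase w <= 1 / 2.
Proof.
have /andP[] := ceil_itv (2 * w); rewrite /phase intrB => ? ?.
by apply/andP; split; lra.
Qed.

Lemma kept_period_phase h w : 0 <= h <= 1 / 2 ->
  kept_period h w = Num.ceil (2 * w) - (phase w <= h)%R%:Z.
Proof.
move=> /andP[h0 h1]; have /andP[p0 p1] := phase_gt0_le w.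
apply: ceil_def; move: p0 p1; rewrite /phase !intrB.
by case: (leP _ h) => ? ? ? /=; apply/andP; split; lra.
Qed.

Lemma canonical_offsets_val (reqs : seq (request G)) :
  (canonical_offsets_timed reqs).1 =
  0 :: (midpoints_timed (sort_timed [seq phase (wstart q) | q <- reqs]).1).1.
Proof.
rewrite /canonical_offsets_timed /bind.
have := map_timed_val (@phase_timed R G) reqs; case: map_timed => hs c /= ->.
rewrite -[map _ _]/(map (fun q : request G => phase (wstart q)) reqs).
by case: sort_timed => t d /=; case: midpoints_timed.
Qed.

Lemma canonical_offsets_dominate (reqs : seq (request G)) h :
  0 <= h <= 1 / 2 ->
  exists2 h', h' \in (canonical_offsets_timed reqs).1 &
  exists d, forall k, let w := wstart (tnth (in_tuple reqs) k) in
    period_start h' (kept_period h' w) = period_start h (kept_period h w) + d.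
Proof.
move=> h01; rewrite canonical_offsets_val; set l := map _ reqs.
have memS := perm_mem (sort_timed_perm l).
have mem_l k : phase (wstart (tnth (in_tuple reqs) k)) \in (sort_timed l).1.
  rewrite memS; apply/(nthP 0); exists k; first by rewrite size_map.
  rewrite (nth_map (tnth (in_tuple reqs) k)) //.
  by rewrite [in RHS](tnth_nth (tnth (in_tuple reqs) k)).
have srt := sort_timed_sorted l.
have zz : 0 <= (0 : R) <= 1 / 2 by apply/andP; split; lra.
have phase0 w : (phase w <= 0) = false.
  by apply/negbTE; rewrite -ltNge; case/andP: (phase_gt0_le w).
have [has_le|] := boolP (has (<= h) (sort_timed l).1); last first.
  move=> /hasPn no_le; exists 0; first exact: mem_head.
  exists (- h) => k w; rewrite !kept_period_phase // phase0.
  have /negbTE-> : ~~ (phase w <= h) := no_le _ (mem_l k).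
  by rewrite /period_start; lra.
have [has_gt|] := boolP (has (> h) (sort_timed l).1); last first.
  move=> /hasPn no_gt; exists 0; first exact: mem_head.
  exists (1 / 2 - h) => k w; rewrite !kept_period_phase // phase0.
  have : ~~ (h < phase w) := no_gt _ (mem_l k); rewrite -leNgt => ->.
  by rewrite /period_start intrB /=; lra.
have [x [y [mid xl yl /andP[xh hy] xyP]]] := midpoint_around srt has_le has_gt.
exists ((x + y) / 2); first by rewrite inE mid orbT.
have /allP l_itv : all (fun z => 0 < z <= 1 / 2) l.
  by rewrite /l; elim: (reqs) => //= q qs ->; rewrite phase_gt0_le.
have /andP[/ltW x0 _] : 0 < x <= 1 / 2 by apply: l_itv; rewrite -memS.
have /andP[_ y1] : 0 < y <= 1 / 2 by apply: l_itv; rewrite -memS.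
exists ((x + y) / 2 - h) => k w.
rewrite !kept_period_phase //; last by apply/andP; split; lra.
have -> : (phase w <= (x + y) / 2) = (phase w <= h).
  by case: (xyP (phase w) (mem_l k)) => ?; apply/idP/idP => ?; lra.
by rewrite /period_start; lra.
Qed.
End CanonicalOffsets.

Section Best.
Variables (R : realType) (k : network_kind) (gamma : R) (Gamma : nat -> nat).
Variables (repair : repair_algorithm R).
Hypothesis spec : repair_spec k gamma Gamma repair.
Variables (G : metric_graph R) (reqs : seq (request G)) (s : R).
Hypotheses (kG : of_kind k G) (s_gt0 : 0 < s).

Let out h := (repair (trim_all_timed h reqs).1 s).1.

Lemma best_over_timed_val (offsets : seq R) best :
  (forall b, best = Some b ->
    runs_at_speed s b.1 /\ b.2 <= total_profit reqs b.1) ->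
  (0 < size offsets)%N || isSome best ->
  exists rho, [/\ (best_over_timed repair reqs s offsets best).1 = Some rho,
    runs_at_speed s rho, forall b, best = Some b -> b.2 <= total_profit reqs rho
    & {in offsets, forall h, (out h).2 <= total_profit reqs rho}].
Proof.
elim: offsets best => [|h l IH] best /=.
  case: best => // b /(_ b erefl)[okb leb] _; exists b.1; split=> //.
  by move=> _ [<-].
move=> bestP _.
have outP : runs_at_speed s (out h).1 /\ (out h).2 <= total_profit reqs (out h).1.
  rewrite /out (repair_value spec) //; split.
    exact: (repair_feasible spec).
  exact: trimmed_profit_le.
move: outP; rewrite /out; case IE: (trim_all_timed h reqs) => [I c] /=.
case oE: (repair I s) => [o d] /= outP.
set better := if best is Some b then b.2 < o.2 else true.
have [|//|rho [rhoE ok le_best le_out]] := IH (if better then Some o else best).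
- by case: better => // b [<-].
- by rewrite /better; case: (best) => [b|] /=; rewrite ?orbT //; case: ifP; rewrite orbT.
exists rho; split=> //.
- by move: rhoE; rewrite /= ; case: best_over_timed.
- move=> b bE; move: le_best; rewrite /better bE.
  case: ltP => [lt_bo le_best|_ le_best]; last exact: le_best.
  by apply: le_trans (ltW lt_bo) _; apply: le_best.
- move=> h'; rewrite inE => /orP[/eqP->|/le_out//].
  rewrite /out IE /= oE /=; move: le_best; rewrite /better; case: (best) => [b|].
    case: ltP => [_ le_best|le_ob le_best]; first exact: le_best.
    by apply: le_trans le_ob _; apply: le_best.
  by apply.
Qed.
End Best.

Section RunningTime.
Variable R : realType.

Lemma map_timed_cost (A B : Type) (f : A -> timed B) (c : nat) (l : seq A) :
  (forall x, (f x).2 = c) -> (map_timed f l).2 = (size l * c.+1)%N.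
Proof.
move=> fc; elim: l => //= x l; have := fc x; case: (f x) => y d /= ->.
by case: (map_timed f l) => ys e /= ->; rewrite mulSn; lia.
Qed.

Lemma insert_timed_cost (x : R) l : ((insert_timed x l).2 <= 2 * size l + 1)%N.
Proof.
elim: l => //= y l IH; case: ifP => /= _; first by lia.
by case: (insert_timed x l) IH => t c /=; lia.
Qed.

Lemma sort_timed_cost (l : seq R) :
  ((sort_timed l).2 <= size l * (2 * size l + 1))%N.
Proof.
elim: l => //= x l; have := perm_size (sort_timed_perm l).
case: (sort_timed l) => t c /= st IH; have := insert_timed_cost x t.
by case: (insert_timed x t) => u d /=; rewrite st; nia.
Qed.

Lemma midpoints_timed_cost (l : seq R) :
  ((midpoints_timed l).2 <= 3 * size l)%N /\
  size (midpoints_timed l).1 = (size l).-1.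
Proof.
elim: l => // x [|y l] // [IHc IHs]; split.
  move: IHc => /=; case: (match l with nil => _ | cons _ _ => _ end) => ? ? /=.
  by lia.
by move: IHs => /=; case: (match l with nil => _ | cons _ _ => _ end) => ? ? /= ->.
Qed.

Variable G : metric_graph R.
Implicit Type reqs : seq (request G).

Lemma canonical_offsets_cost reqs : (0 < size reqs)%N ->
  ((canonical_offsets_timed reqs).2 <= 13 * (size reqs * size reqs))%N /\
  size (canonical_offsets_timed reqs).1 = size reqs.
Proof.
move=> m0; have := canonical_offsets_val reqs; rewrite /canonical_offsets_timed /bind.
have := map_timed_val (@phase_timed R G) reqs.
have := @map_timed_cost _ _ (@phase_timed R G) 5 reqs (fun=> erefl).
case: map_timed => hs c /= -> hsE.
have shs : size hs = size reqs by rewrite hsE size_map.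
have := sort_timed_cost hs; have := perm_size (sort_timed_perm hs).
case: sort_timed => t d /= st dle.
have := midpoints_timed_cost t; case: midpoints_timed => u e /= [ele su] _.
by rewrite su st shs; split; nia.
Qed.

Lemma trim_all_cost h reqs : (trim_all_timed h reqs).2 = (5 * size reqs).+1.
Proof.
rewrite /trim_all_timed /bind.
have := @map_timed_cost _ _ (@trim_timed R G h) 4 reqs (fun=> erefl).
by case: map_timed => ts c /= ->; lia.
Qed.

Lemma uniform_offsets_cost r : (uniform_offsets_timed R r).2 = (r * 4)%N /\
  (uniform_offsets_timed R r).1 = [seq uniform_offset R r i | i <- iota 0 r].
Proof.
rewrite /uniform_offsets_timed map_timed_val; split.
  by rewrite (@map_timed_cost _ _ _ 3) ?size_iota.
by rewrite (iotaDl 1 0) -map_comp.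
Qed.

Variables (k : network_kind) (gamma : R) (Gamma : nat -> nat).
Variables (repair : repair_algorithm R).
Hypothesis spec : repair_spec k gamma Gamma repair.

Lemma best_over_timed_cost reqs s (offsets : seq R) best :
  of_kind k G -> 0 < s -> (size reqs <= Gamma #|vertex G|)%N ->
  ((best_over_timed repair reqs s offsets best).2
    <= size offsets * (5 * size reqs + 2 + Gamma #|vertex G|))%N.
Proof.
move=> kG s0 mG; elim: offsets best => //= h l IH best.
have := trim_all_cost h reqs; have := trim_all_requests h reqs.
case: (trim_all_timed h reqs) => I c /= reqI ->.
have := repair_time spec kG s0 (I := I); rewrite reqI size_map => /(_ mG).
case: (repair I s) => o d /= dG.
set better := if best is Some b then b.2 < o.2 else true.
have := IH (if better then Some o else best).
by case: best_over_timed => res e /=; lia.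
Qed.
End RunningTime.

Lemma runs_at_speed_le (R : realType) (G : metric_graph R) (s s' : R)
    (rho : service_run G) :
  0 < s -> s <= s' -> runs_at_speed s rho -> runs_at_speed s' rho.
Proof.
move=> s0 ss' /andP[ok pp]; rewrite /runs_at_speed ok /=.
apply: sub_path pp => a b /andP[ab lab]; rewrite /leg ab /=.
apply: (le_trans lab); apply: ler_wpM2r => //.
by rewrite -(pmulr_rge0 _ s0) (le_trans (ltW (len_gt0 ab))).
Qed.

Lemma le_of_rational_speeds (R : realType) (s P B : R) : 1 < s -> 0 <= P ->
  (forall q r, (0 < r)%N -> (1 : R) <= q%:R / r%:R <= s ->
    (q%:R / r%:R + 1) / 6 * P <= B) ->
  (s + 1) / 6 * P <= B.
Proof.
move=> s1 P0 le_B; rewrite leNgt; apply/negP => lt_B.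
have P_gt0 : 0 < P.
  rewrite lt_neqAle P0 andbT eq_sym; apply/eqP => PE.
  have := le_B 1%N 1%N isT; rewrite divr1 PE mulr0 => /(_ _).
  by move: lt_B; rewrite PE mulr0 lexx (ltW s1) => lt_B /(_ isT); lra.
have lt_s : Num.max 1 (6 * B / P - 1) < s.
  rewrite gt_max s1 /= ltrBlDr ltr_pdivrMr //; lra.
have [x] := rat_in_itvoo lt_s.
rewrite in_itv /= gt_max => /andP[/andP[x1 xB] xs].
have x0 : 0 < x by rewrite -(ltr0q R); lra.
have xE : ratr x = `|numq x|%N%:R / `|denq x|%N%:R :> R.
  rewrite /ratr !pmulrn (gez0_abs (ltW (denq_gt0 x))) gez0_abs //.
  by rewrite numq_ge0 ltW.
have := le_B `|numq x|%N `|denq x|%N; rewrite -xE absz_gt0 denq_neq0.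
rewrite (ltW x1) (ltW xs) => /(_ isT isT).
move: xB; rewrite ltrBlDr ltr_pdivrMr //; lra.
Qed.

Lemma cost_bound (m g t c d : nat) :
  (0 < m <= g)%N -> (0 < t)%N -> (c <= 13 * (t * g))%N ->
  (d <= t * (5 * m + 2 + g))%N -> (m + (1 + (c + d)) <= 25 * (t * g))%N.
Proof.
move=> mg t0 cle dle.
have : (t * (5 * m + 2 + g) <= t * (8 * g))%N by rewrite leq_mul2l; lia.
rewrite [(t * (8 * g))%N]mulnCA; have := leq_pmull g t0.
by move: (t * _)%N (t * g)%N dle cle => ? ?; lia.
Qed.

Theorem theorem4 (R : realType) :
  exists C : nat,
  forall (k : network_kind) (gamma : R) (Gamma : nat -> nat)
    (repair : repair_algorithm R),
  0 < gamma -> repair_spec k gamma Gamma repair ->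
  forall (G : metric_graph R) (reqs : seq (request G)) (s : R) (r : option nat),
  of_kind k G -> 1 <= s <= 2 -> speed_denominator s r ->
  (exists2 rho : service_run G,
     (speedup repair reqs s r).1 = Some rho &
     runs_at_speed s rho /\
     forall Rstar : service_run G, is_optimal reqs 1 Rstar ->
       (s + 1) / (6 * gamma) * total_profit reqs Rstar
         <= total_profit reqs rho) /\
  ((0 < size reqs <= Gamma #|vertex G|)%N ->
   ((speedup repair reqs s r).2
      <= C * (min_denominator r (size reqs) * Gamma #|vertex G|))%N).
Proof.
exists 25%N => k gamma Gamma repair gamma0 spec G reqs s r kG /andP[s1 s2] den.
have s0 : 0 < s by lra.
set uni := if r is Some r' then (r' < size reqs)%N else false.
pose offs := if uni then uniform_offsets_timed R (odflt 0%N r)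
             else canonical_offsets_timed reqs.
have -> : speedup repair reqs s r = ((best_over_timed repair reqs s offs.1 None).1,
    (size reqs + (1 + (offs.2 + (best_over_timed repair reqs s offs.1 None).2)))%N).
  rewrite /speedup /size_timed /bind /op /offs /uni.
  case: (if _ then _ else _) => o c /=; case: best_over_timed => res d /=; congr pair; lia.
split; last first.
  move=> /andP[m0 mG].
  have := best_over_timed_cost spec offs.1 None kG s0 mG.
  case: best_over_timed => res d /= {res}.
  rewrite /offs; case: ifP => uniE.
    move: uniE; rewrite /uni; case: r den {uni offs} => //= r den rm.
    have r0 : (0 < r)%N by inversion den.
    have [-> ->] := uniform_offsets_cost R r; rewrite size_map size_iota => dle.
    have -> : minn r (size reqs) = r by lia.
    apply: cost_bound dle => //; first by rewrite m0.
    rewrite [(13 * _)%N]mulnCA leq_mul2l; apply/orP; right.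
    by have := leq_trans m0 mG; case: (Gamma _) => // g; lia.
  have [cle ->] := canonical_offsets_cost m0 => dle.
  have -> : min_denominator r (size reqs) = size reqs.
    by move: uniE; rewrite /uni /min_denominator; case: (r) => // r'; lia.
  apply: cost_bound dle => //; first by rewrite m0.
  by apply: leq_trans cle _; rewrite !leq_mul2l mG !orbT.
have offs_ne : (0 < size offs.1)%N || isSome (None : option (service_run G * R)).
  rewrite orbF /offs; case: ifP => uniE; last by rewrite canonical_offsets_val.
  move: uniE; rewrite /uni; case: r den {uni offs} => //= r den rm.
  have [_ ->] := uniform_offsets_cost R r; rewrite size_map size_iota.
  by inversion den.
have [//|rho [rhoE ok _ best]] := best_over_timed_val spec (reqs := reqs) kG s0 _ offs_ne.
exists rho => //; split=> // Rstar [okstar _].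
have P0 : 0 <= total_profit reqs Rstar.
  by apply: sumr_ge0 => q _; apply: profit_ge0.
pose B := gamma * total_profit reqs rho.
suff le_B : (s + 1) / 6 * total_profit reqs Rstar <= B.
  rewrite -(ler_pM2l gamma0); apply: le_trans le_B.
  by rewrite le_eqVlt; apply/orP; left; apply/eqP; field; rewrite gt_eqF.
have offs_bound h rho' : h \in offs.1 -> runs_at_speed s rho' ->
    trimmed_profit (trim_all_timed h reqs).1 rho' <= B.
  move=> /best le_h ok'; rewrite -(ler_pM2l (_ : 0 < gamma^-1)) ?invr_gt0 //.
  rewrite /B mulKf ?gt_eqF //; apply: le_trans le_h.
  by rewrite (repair_value spec) //; apply: (repair_approx spec).
have canonical_bound h rho' : ~~ uni -> 0 <= h <= 1 / 2 -> runs_at_speed s rho' ->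
    trimmed_profit (trim_all_timed h reqs).1 rho' <= B.
  move=> /negbTE not_uni h01 ok'.
  have [h' h'in [d hh']] := canonical_offsets_dominate reqs h01.
  apply: le_trans (shift_trimmed_profit rho' hh') _.
  by apply: offs_bound; [rewrite /offs not_uni | apply: shift_runs_at_speed].
have uniform_itv r' i : (i < r')%N -> 0 <= uniform_offset R r' i <= 1 / 2.
  move=> ir; have r'0 : 0 < r'%:R :> R by rewrite ltr0n (leq_ltn_trans _ ir).
  rewrite /uniform_offset divr_ge0 //= ?mulr_ge0 //.
  have : (i%:R : R) <= r'%:R by rewrite ler_nat ltnW.
  by rewrite ler_pdivrMr ?mulr_gt0 //; lra.
case: den @uni @offs offs_ne canonical_bound offs_bound {rhoE best} =>
    [q r' r'0 _ sE|irr] uni offs _ canonical_bound offs_bound.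
  have r'R : 0 < r'%:R :> R by rewrite ltr0n.
  have qr : (r' <= q <= 2 * r')%N.
    move: s1 s2; rewrite sE ler_pdivlMr // ler_pdivrMr // mul1r -natrM !ler_nat.
    by move=> -> ->.
  rewrite sE; apply: average_trimmed_profit qr okstar _ => // i rho' ir.
  rewrite -sE => ok'; case: (boolP uni) => uniE.
    apply: offs_bound => //; rewrite /offs uniE /=.
    have [_ ->] := uniform_offsets_cost R r'.
    by apply: map_f; rewrite mem_iota.
  by apply: canonical_bound => //; apply: uniform_itv.
have s_gt1 : 1 < s.
  rewrite lt_neqAle s1 andbT; apply/eqP => sE.
  by apply: (irr 1); rewrite rmorph1.
apply: le_of_rational_speeds => // q r' r'0 /andP[qr1 qrs].
have r'R : 0 < r'%:R :> R by rewrite ltr0n.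
apply: average_trimmed_profit okstar _ => // [|i rho' ir ok'].
  move: qr1 (le_trans qrs s2); rewrite ler_pdivlMr // ler_pdivrMr // mul1r -natrM !ler_nat.
  by move=> -> ->.
apply: canonical_bound => //; first exact: uniform_itv.
by apply: runs_at_speed_le qrs ok'; lra.
Qed.
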